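(* There exist universal constants $c_1,c_2,c_3>0$ such that the following holds. Let $n\ge 2$ and $p\ge 2$ be integers, let $\Sigma^*$ be a $p\times p$ symmetric positive definite matrix such that $\Theta^*:=(\Sigma^* )^{-1}\in\mathcal{M}^{p\times p}$ (i.e. all off-diagonal entries of $\Theta^*$ are nonpositive), let $X\in\mathbb{R}^{n\times p}$ be a random matrix with i.i.d. $\mathcal{N}(0,\Sigma^* )$ rows, let $S=n^{-1}X^{\mathsf T}X$, and let $\widehat\Theta$ be the constrained maximum likelihood estimator $$\widehat\Theta=\operatorname{argmin}_{\Theta\in\mathcal{M}^{p\times p}}\{\langle\Theta,S\rangle-\log\det\Theta\}.$$ If $n\ge c_1\,\gamma(\Sigma^* )^2\log p$, then with probability at least $1-c_3p^{-2}$, $$L^{\mathrm{ssym}}(\widehat\Theta,\Theta^* )\le c_2\,\gamma(\Sigma^* )\sqrt{\frac{\log p}{n}}.$$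
   Context: $\mathcal{M}^{p\times p}$ is the set of $p\times p$ symmetric positive semidefinite matrices $\Theta$ with $\Theta_{jk}\le 0$ for all $j\neq k$. $\langle A,B\rangle=\mathrm{tr}(A^{\mathsf T}B)$ is the Frobenius inner product, and $-\log\det\Theta=+\infty$ for singular $\Theta$. For $n\ge 2$ the minimizer $\widehat\Theta$ exists, is unique and is nonsingular with probability one (a known fact). The symmetrized Stein loss between symmetric positive definite $p\times p$ matrices $\Theta,\Theta^*$ with inverses $\Sigma=\Theta^{-1}$, $\Sigma^*=(\Theta^* )^{-1}$ is $$L^{\mathrm{ssym}}(\Theta,\Theta^* )=\frac{1}{2p}\langle\Theta-\Theta^*,\Sigma^*-\Sigma\rangle .$$ For a positive definite $\Sigma^*$, $$\gamma(\Sigma^* )=\left(1-\max_{j\ne k}\frac{\Sigma^*_{jk}}{\sqrt{\Sigma^*_{jj}\Sigma^*_{kk}}}\right)^{-1}.$$ ''Universal'' means not depending on $n,p,\Sigma^*$. *)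

(* Defs.v *)
From HB Require Import structures.
From mathcomp Require Import all_boot all_order all_algebra.
From mathcomp Require Import all_classical all_reals all_analysis.

Set Implicit Arguments.
Unset Strict Implicit.
Unset Printing Implicit Defensive.
Import Order.TTheory GRing.Theory Num.Theory.
Import numFieldNormedType.Exports.

Local Open Scope classical_set_scope.
Local Open Scope ring_scope.

Definition quadform (R : realType) (p : nat) (A : 'M[R]_p) (u : 'cV[R]_p) : R :=
  (u^T *m A *m u) 0 0.

Definition psd (R : realType) (p : nat) (A : 'M[R]_p) : Prop :=
  A^T = A /\ forall u : 'cV[R]_p, 0 <= quadform A u.

Definition posdef (R : realType) (p : nat) (A : 'M[R]_p) : Prop :=
  A^T = A /\ forall u : 'cV[R]_p, u != 0 -> 0 < quadform A u.

Definition Mset (R : realType) (p : nat) : set 'M[R]_p :=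
  [set A | psd A /\ forall j k : 'I_p, j != k -> A j k <= 0].

Definition frob (R : realType) (p : nat) (A B : 'M[R]_p) : R := \tr (A^T *m B).

Definition neg_log_det (R : realType) (p : nat) (A : 'M[R]_p) : \bar R :=
  if \det A == 0 then +oo%E else (- ln (\det A))%:E.

Definition mle_objective (R : realType) (p : nat) (S A : 'M[R]_p) : \bar R :=
  ((frob A S)%:E + neg_log_det A)%E.

Definition is_mle (R : realType) (p : nat) (S A : 'M[R]_p) : Prop :=
  Mset A /\ forall B : 'M[R]_p, Mset B ->
    (mle_objective S A <= mle_objective S B)%E.

Definition ssym_loss (R : realType) (p : nat) (A B : 'M[R]_p) : R :=
  (2 * p%:R)^-1 * frob (A - B) (invmx B - invmx A).

(* The correlations of a positive definite matrix are greater than -1, so for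
   p >= 2 the initial value -1 does not affect the maximum. *)
Definition max_corr (R : realType) (p : nat) (A : 'M[R]_p) : R :=
  \big[Num.max/-1]_(jk : 'I_p * 'I_p | jk.1 != jk.2)
    (A jk.1 jk.2 / Num.sqrt (A jk.1 jk.1 * A jk.2 jk.2)).

Definition gamma (R : realType) (p : nat) (A : 'M[R]_p) : R :=
  (1 - max_corr A)^-1.

Definition sample_cov (R : realType) (n p : nat) (X : 'M[R]_(n, p)) : 'M[R]_p :=
  n%:R^-1 *: (X^T *m X).

(* Y ~ N(0, A) for A positive definite: every nonzero linear form Y u is
   N(0, u^T A u).  The second parameter of normal_prob is the standard
   deviation; u = 0 is left out because normal_prob 0 0 is not the Dirac mass
   at 0. *)
Definition centered_gaussian (R : realType) (d : measure_display)
    (T : measurableType d) (P : probability T R) (p : nat) (A : 'M[R]_p)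
    (Y : T -> 'rV[R]_p) : Prop :=
  forall (u : 'cV[R]_p), u != 0 -> forall B : set R, measurable B ->
    pushforward P (fun w => (Y w *m u) 0 0) B =
    normal_prob 0 (Num.sqrt (quadform A u)) B.

(* The product rule is over the Borel sigma-algebra of R^p; subfamilies of rows
   are covered by taking some of the B i to be the whole space. *)
Definition independent_rows (R : realType) (d : measure_display)
    (T : measurableType d) (P : probability T R) (n p : nat)
    (X : T -> 'M[R]_(n, p)) : Prop :=
  forall B : 'I_n -> set 'rV[R]_p,
    (forall i, <<s [set U : set 'rV[R]_p | open U] >> (B i)) ->
    P [set w | forall i, B i (row i (X w))] =
    (\prod_(i < n) P [set w | B i (row i (X w))])%E.

Definition iid_gaussian_rows (R : realType) (d : measure_display)
    (T : measurableType d) (P : probability T R) (n p : nat) (A : 'M[R]_p)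
    (X : T -> 'M[R]_(n, p)) : Prop :=
  [/\ forall i j, measurable_fun setT (fun w => X w i j),
      forall i, centered_gaussian P A (fun w => row i (X w))
    & independent_rows P X].

(* Main.v *)
(* Stationarity of the estimator along the ray through itself and in the
   direction Theta* of the cone M gives <Theta_hat, S> <= p and
   <Theta*, Theta_hat^-1> <= <Theta*, S>, so that
     2 p L(Theta_hat, Theta* ) <= <Theta_hat - Theta*, Sigma* - S>.
   Put d_j = sqrt(Sigma*_jj).  For B in M, d^T B d >= 0 bounds the weighted
   l1 norm sum |B_jk| d_j d_k by twice T(B) = sum_j B_jj d_j^2, and the gap
   between the correlations and 1 gives T(B) <= const * gamma * <B, A> for
   A = Sigma* and for A = S close to Sigma*.  Hence T(Theta* ) and T(Theta_hat)
   are O(gamma p), and the loss is O(gamma) times the largest normalized entry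
   of S - Sigma*.  That entry is O(sqrt(log p / n)) by chi-square concentration
   of S and Sigma* along the p^2 pairs of directions e_j / d_j +- e_k / d_k. *)
Require Import Defs.
From HB Require Import structures.
From mathcomp Require Import all_boot all_order all_algebra.
From mathcomp Require Import all_classical all_reals all_analysis.
From mathcomp Require Import measurable_realfun measurable_fun_approximation.
From mathcomp Require Import ring lra.

Set Implicit Arguments.
Unset Strict Implicit.
Unset Printing Implicit Defensive.

Import Order.TTheory GRing.Theory Num.Theory.
Import numFieldNormedType.Exports.
Local Open Scope classical_set_scope.
Local Open Scope ring_scope.

(** * Symmetric matrices and determinants *)

Section LinearAlgebra.
Context {R : realType}.

Lemma quadformE p (A : 'M[R]_p) (u : 'cV[R]_p) :
  quadform A u = \sum_j \sum_k A j k * (u j 0 * u k 0).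
Proof.
rewrite /quadform !mxE exchange_big /=.
apply: eq_bigr => k _; rewrite !mxE mulr_suml; apply: eq_bigr => j _.
by rewrite mxE mulrA [u j 0 * _]mulrC.
Qed.

Lemma frobE p (A B : 'M[R]_p) : frob A B = \sum_j \sum_k A j k * B j k.
Proof.
rewrite /frob /mxtrace exchange_big /=.
by apply: eq_bigr => k _; rewrite !mxE; apply: eq_bigr => j _; rewrite mxE.
Qed.

Lemma frobZl p (a : R) (A B : 'M[R]_p) : frob (a *: A) B = a * frob A B.
Proof. by rewrite /frob linearZ /= -scalemxAl linearZ. Qed.

Lemma frobDl p (A B C : 'M[R]_p) : frob (A + B) C = frob A C + frob B C.
Proof. by rewrite /frob linearD /= mulmxDl linearD. Qed.

Lemma frobBl p (A B C : 'M[R]_p) : frob (A - B) C = frob A C - frob B C.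
Proof. by rewrite /frob linearB /= mulmxBl linearB. Qed.

Lemma frobBr p (A B C : 'M[R]_p) : frob C (A - B) = frob C A - frob C B.
Proof. by rewrite /frob mulmxBr linearB. Qed.

Lemma quadformZl p (a : R) (A : 'M[R]_p) u :
  quadform (a *: A) u = a * quadform A u.
Proof. by rewrite /quadform -scalemxAr -scalemxAl mxE. Qed.

Lemma quadformDl p (A B : 'M[R]_p) u :
  quadform (A + B) u = quadform A u + quadform B u.
Proof. by rewrite /quadform mulmxDr mulmxDl mxE. Qed.

Lemma psd_sym p (A : 'M[R]_p) : psd A -> forall j k, A j k = A k j.
Proof. by move=> [At _] j k; rewrite -{1}At mxE. Qed.

Lemma MsetZ p (a : R) (A : 'M[R]_p) : 0 <= a -> Mset A -> Mset (a *: A).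
Proof.
move=> a0 [[At Au] Ao]; split; [split|].
- by rewrite linearZ /= At.
- by move=> u; rewrite quadformZl mulr_ge0.
- by move=> j k jk; rewrite mxE mulr_ge0_le0// Ao.
Qed.

Lemma MsetD p (A B : 'M[R]_p) : Mset A -> Mset B -> Mset (A + B).
Proof.
move=> [[At Au] Ao] [[Bt Bu] Bo]; split; [split|].
- by rewrite linearD /= At Bt.
- by move=> u; rewrite quadformDl addr_ge0.
- by move=> j k jk; rewrite mxE; have := Ao j k jk; have := Bo j k jk; lra.
Qed.

Lemma quadform1 p (u : 'cV[R]_p) : quadform 1%:M u = \sum_j u j 0 ^+ 2.
Proof.
rewrite /quadform mulmx1 mxE; apply: eq_bigr => j _.
by rewrite mxE expr2.
Qed.

Lemma quadform1_gt0 p (u : 'cV[R]_p) : u != 0 -> 0 < quadform 1%:M u.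
Proof.
move=> u0; rewrite quadform1 lt_def sumr_ge0 ?andbT; last first.
  by move=> j _; exact: sqr_ge0.
apply: contra u0 => /eqP/psumr_eq0P h; apply/eqP/colP => j; rewrite mxE.
by apply/eqP; rewrite -sqrf_eq0 h// => i _; exact: sqr_ge0.
Qed.

Lemma posdef1 p : posdef (1%:M : 'M[R]_p).
Proof. by split; [exact: trmx1|exact: quadform1_gt0]. Qed.

Lemma posdef_psd p (A : 'M[R]_p) : posdef A -> psd A.
Proof.
move=> [At Au]; split => // u; have [->|u0] := eqVneq u 0.
  by rewrite /quadform mulmx0 mxE.
exact/ltW/Au.
Qed.

Lemma Mset1 p : Mset (1%:M : 'M[R]_p).
Proof.
split; first exact/posdef_psd/posdef1.
by move=> j k jk; rewrite mxE (negbTE jk).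
Qed.

Lemma posdef_unit p (A : 'M[R]_p) : posdef A -> A \in unitmx.
Proof.
move=> [At Au]; rewrite unitmxE unitfE; apply/det0P => -[v v0 vA].
have := Au v^T; rewrite /quadform trmxK vA mul0mx mxE ltxx trmx_eq0 v0.
by move=> /(_ isT).
Qed.

Lemma quadform_delta2 p (A : 'M[R]_p) (j k : 'I_p) (a b : R) :
  quadform A (a *: delta_mx j 0 + b *: delta_mx k 0) =
  a ^+ 2 * A j j + a * b * (A j k + A k j) + b ^+ 2 * A k k.
Proof.
have E i l :
    ((delta_mx i (0 : 'I_1))^T *m A *m delta_mx l (0 : 'I_1)) 0 0 = A i l.
  by rewrite trmx_delta -rowE -colE !mxE.
have trE : (a *: delta_mx j 0 + b *: delta_mx k 0 : 'cV[R]_p)^T =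
    a *: (delta_mx j 0)^T + b *: (delta_mx k 0)^T.
  by apply/matrixP => x y; rewrite !mxE.
rewrite /quadform trE !mulmxDl !mulmxDr.
have ZlE c (M : 'rV[R]_p) (N : 'cV[R]_p) : c *: M *m N = c *: (M *m N).
  by rewrite scalemxAl.
have ZlE' c (M : 'rV[R]_p) : c *: M *m A = c *: (M *m A) by rewrite scalemxAl.
have ZrE c (M : 'rV[R]_p) (N : 'cV[R]_p) : M *m (c *: N) = c *: (M *m N).
  by rewrite scalemxAr.
rewrite !(ZlE', ZlE, ZrE).
have DE (M N : 'M[R]_1) : (M + N) 0 0 = M 0 0 + N 0 0 by rewrite mxE.
have ZE c (M : 'M[R]_1) : (c *: M) 0 0 = c * M 0 0 by rewrite mxE.
by rewrite !(DE, ZE) !E; ring.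
Qed.

Lemma psd_diag_ge0 p (A : 'M[R]_p) j : psd A -> 0 <= A j j.
Proof.
move=> [_ /(_ (1 *: delta_mx j 0 + 0 *: delta_mx j 0))].
by rewrite quadform_delta2; lra.
Qed.

(** Testing on e_j + e_k and e_j - e_k gives 2 |A_jk| <= A_jj + A_kk, and the trace dominates each
    diagonal entry since the others are nonnegative. Hence a bound on the trace bounds the whole
    matrix. *)
Lemma psd_entry_le p (A : 'M[R]_p) j k : psd A -> `|A j k| <= \tr A.
Proof.
move=> Apsd; have tr_ge i : A i i <= \tr A.
  rewrite /mxtrace (bigD1 i)//= lerDl sumr_ge0// => l _; exact: psd_diag_ge0.
have /= := Apsd.2 (1 *: delta_mx j 0 + 1 *: delta_mx k 0).
have /= := Apsd.2 (1 *: delta_mx j 0 + (-1) *: delta_mx k 0).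
rewrite !quadform_delta2 -(psd_sym Apsd j k) ler_norml.
by have := tr_ge j; have := tr_ge k; lra.
Qed.

Lemma posdef_det_neq0 p (A : 'M[R]_p) : posdef A -> \det A != 0.
Proof. by move=> /posdef_unit; rewrite unitmxE unitfE. Qed.

(* Along the segment from 1 to A the determinant has no zero before A. *)
Lemma det_psd_ge0 p (A : 'M[R]_p) : psd A -> 0 <= \det A.
Proof.
move=> [At Au].
pose q : {poly R} := \det (1%:M + 'X *: map_mx polyC (A - 1%:M)).
have qE x : q.[x] = \det (1%:M + x *: (A - 1%:M)).
  rewrite /q -horner_evalE -det_map_mx; congr (\det _).
  apply/matrixP => i j; rewrite !mxE /= /horner_eval hornerD hornerM hornerX.
  by rewrite hornerC -polyC_natr hornerC.
have q1 : q.[1] = \det A by rewrite qE scale1r addrC subrK.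
have q0 : q.[0] = 1 by rewrite qE scale0r addr0 det1.
rewrite leNgt -q1; apply/negP => qneg.
have [||x /andP[x0 x1] rx] := @poly_ivt _ (- q) 0 1; first exact: ler01.
  by rewrite !hornerN q0 oppr_le0 ler01 oppr_ge0 ltW.
rewrite rootN in rx.
have /negP[] : \det (1%:M + x *: (A - 1%:M)) != 0.
  apply: posdef_det_neq0; split.
    by rewrite linearD linearZ /= linearB /= trmx1 At.
  move=> u u0; have -> : 1%:M + x *: (A - 1%:M) = (1 - x) *: 1%:M + x *: A.
    by rewrite scalerBl scale1r scalerBr addrA [in LHS]addrAC.
  rewrite quadformDl !quadformZl.
  have := quadform1_gt0 u0; move: (Au u) => Au0 u1.
  (* The root is not 1, where [q] is negative; the identity thus keeps a positive weight 1 - x and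
     the combination is positive definite. *)
  have x1' : x < 1.
    by rewrite lt_neqAle x1 andbT; apply: contraTneq rx => ->; rewrite /root lt_eqF.
  by rewrite ltr_wpDr ?mulr_ge0 ?mulr_gt0 ?subr_gt0.
by move: rx; rewrite /root qE.
Qed.

(** A one-sided first-order expansion. Write det (1 + t A) as t^p times the characteristic
    polynomial of - A at 1/t: its two top coefficients are 1 and tr A, and every other term carries
    at least t^2. *)
Lemma det_unitD p (A : 'M[R]_p) : exists2 C, 0 <= C &
  forall t, 0 < t <= 1 -> 1 + t * \tr A - t ^+ 2 * C <= \det (1%:M + t *: A).
Proof.
case: p A => [|p] A.
  exists 0 => // t _; rewrite det_mx00 /mxtrace big_ord0; lra.
pose q := char_poly (- A).
have qE x : \det (x%:M + A) = q.[x].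
  rewrite /q /char_poly -horner_evalE -det_map_mx; congr (\det _).
  apply/matrixP => i j; rewrite !mxE /= /horner_eval hornerD hornerN hornerC opprK.
  by case: eqVneq => _; rewrite ?hornerMn ?hornerX ?mulr1n ?mulr0n ?horner0.
exists (\sum_(i < p) `|q`_i|); first by apply: sumr_ge0.
move=> t /andP[t0 t1].
have tn0 : t != 0 by rewrite gt_eqF.
have -> : 1%:M + t *: A = t *: ((t^-1)%:M + A).
  by rewrite scalerDr scale_scalar_mx divff.
rewrite detZ qE horner_coef size_char_poly !big_ord_recr /=.
have -> : q`_p.+1 = 1.
  by have /monicP := char_poly_monic (- A); rewrite /lead_coef size_char_poly.
have -> : q`_p = \tr A.
  by have := char_poly_trace (- A) (ltn0Sn p); rewrite raddfN opprK.
have tX i : (i <= p.+1)%N -> t ^+ p.+1 * t^-1 ^+ i = t ^+ (p.+1 - i).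
  by move=> ip; rewrite exprVn expfB_cond// (negbTE tn0).
rewrite !mulrDr mulrCA (tX p)// mul1r (tX p.+1)// subnn subSnn expr0 expr1.
suff : - (t ^+ 2 * \sum_(i < p) `|q`_i|) <=
    t ^+ p.+1 * \sum_(i < p) q`_i * t^-1 ^+ i by lra.
rewrite -mulrN -sumrN !mulr_sumr; apply: ler_sum => i _.
rewrite mulrCA tX; last exact/leqW/ltnW/ltn_ord.
(* The factor t^2 is split off; the remaining power of t is at most 1. *)
have -> : (p.+1 - i = 2 + (p.-1 - i))%N.
  by case: (p) i => [[]//|p' i]; rewrite /= addnBA ?add2n// -ltnS.
rewrite exprD mulrCA ler_wpM2l ?exprn_ge0 ?(ltW t0)//.
have /andP[u0 u1] : 0 <= t ^+ (p.-1 - i) <= 1.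
  by rewrite exprn_ge0 ?exprn_ile1 ?(ltW t0).
rewrite lerNl (le_trans (ler_norm _))// normrN normrM (ger0_norm u0).
exact: ler_piMr.
Qed.

(** Subtract (1 - kappa + eps) d^T B d >= 0 from <B, A>. Each off-diagonal term becomes a product of
    two nonpositive factors, and each diagonal one keeps at least (kappa - 2 eps) B_jj d_j^2. *)
Lemma frob_ge p (A B : 'M[R]_p) (d : 'I_p -> R) (kappa eps : R) :
  Mset B -> (forall j, (1 - eps) * d j ^+ 2 <= A j j) ->
  (forall j k, j != k -> A j k <= (1 - kappa + eps) * (d j * d k)) ->
  0 <= 1 - kappa + eps ->
  (kappa - 2 * eps) * (\sum_j B j j * d j ^+ 2) <= frob B A.
Proof.
move=> [Bpsd Bo] Ad Ao k0.
have /(mulr_ge0 k0) := Bpsd.2 (\col_j d j).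
rewrite quadformE frobE => Q; rewrite -subr_ge0.
apply: le_trans Q _; rewrite !mulr_sumr -sumrB; apply: ler_sum => j _.
rewrite mulr_sumr [leRHS]addrC -lerBlDl opprK (bigD1 j)//= [leRHS](bigD1 j)//=.
rewrite addrAC lerD//.
  rewrite !mxE; have := ler_wpM2l (psd_diag_ge0 j Bpsd) (Ad j); nra.
apply: ler_sum => k kj; rewrite !mxE mulrCA.
by apply: ler_wnM2l; [rewrite Bo// eq_sym|rewrite Ao// eq_sym].
Qed.

(** Since d^T B d >= 0 and B has nonpositive off-diagonal entries, the off-diagonal weighted l1 mass
    is at most the diagonal one; hence the factor 2. *)
Lemma frob_le p (E B : 'M[R]_p) (d : 'I_p -> R) (eps : R) :
  Mset B -> (forall j k, `|E j k| <= eps * (d j * d k)) -> 0 <= eps ->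
  `|frob B E| <= 2 * eps * (\sum_j B j j * d j ^+ 2).
Proof.
move=> [Bpsd Bo] Ed e0.
have /(mulr_ge0 e0) := Bpsd.2 (\col_j d j).
rewrite quadformE frobE => Q.
apply: (le_trans (ler_norm_sum _ _ _)).
rewrite -subr_ge0; apply: le_trans Q _.
rewrite !mulr_sumr -sumrB; apply: ler_sum => j _.
rewrite [leRHS]addrC -lerBlDl opprK mulr_sumr.
apply: (le_trans (lerD (lexx _) (ler_norm_sum _ _ _))).
rewrite (bigD1 j)//= [X in _ + X <= _](bigD1 j)//= addrACA -[leRHS]addr0 lerD//.
  rewrite !mxE normrM (ger0_norm (psd_diag_ge0 j Bpsd)).
  have := ler_wpM2l (psd_diag_ge0 j Bpsd) (Ed j j); nra.
rewrite -big_split /= sumr_le0// => k kj; rewrite !mxE normrM.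
have Bjk : B j k <= 0 by rewrite Bo// eq_sym.
rewrite (ler0_norm Bjk).
have := ler_wnM2l Bjk (Ed j k); nra.
Qed.

End LinearAlgebra.

(** * The maximum likelihood estimator *)

Section Mle.
Context {R : realType}.

Lemma mle_objectiveE p (S A : 'M[R]_p) : 0 < \det A ->
  mle_objective S A = (frob A S - ln (\det A))%:E.
Proof. by move=> A0; rewrite /mle_objective /neg_log_det gt_eqF. Qed.

(** The objective is finite at the identity, so a minimizer is not singular. *)
Lemma mle_det_gt0 p (S A : 'M[R]_p) : is_mle S A -> 0 < \det A.
Proof.
move=> [[Apsd _] /(_ _ (Mset1 _))]; rewrite (mle_objectiveE S (A := 1%:M)) ?det1//.
rewrite /mle_objective /neg_log_det lt_def det_psd_ge0// andbT.
by case: ifP => // _; rewrite leye_eq.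
Qed.

(** Comparing A with t A for t < 1 gives (1 - t) <A, S> <= - p ln t <= p (1/t - 1), that is t <A, S>
    <= p; then t tends to 1. *)
Lemma mle_frob_le p (S A : 'M[R]_p) : is_mle S A -> frob A S <= p%:R.
Proof.
move=> mleA; have A0 := mle_det_gt0 mleA; move: mleA => [AM Amin].
suff H t : 0 < t < 1 -> t * frob A S <= p%:R.
  rewrite leNgt; apply/negP => pa.
  have p0 : 0 <= p%:R :> R by [].
  have a0 : 0 < frob A S by apply: le_lt_trans pa.
  (* This t is the midpoint of p / <A, S> and 1, for which t <A, S> still exceeds p. *)
  have := H ((frob A S + p%:R) / (2 * frob A S)).
  rewrite divr_gt0 ?mulr_gt0 ?ltr_wpDr// ltr_pdivrMr ?mulr_gt0// mul1r.
  rewrite invfM mulrA divfK ?gt_eqF//; lra.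
move=> /andP[t0 t1].
have tdet : 0 < \det (t *: A) by rewrite detZ mulr_gt0// exprn_gt0.
have := Amin _ (MsetZ (ltW t0) AM).
rewrite !mle_objectiveE// lee_fin frobZl detZ lnM ?posrE ?exprn_gt0// lnXn//.
have : - ln t <= t^-1 - 1.
  rewrite -lnV ?posrE//; have := @le_ln1Dx R (t^-1 - 1).
  by rewrite (addrC 1) subrK ltrBrDl subrr; apply; rewrite invr_gt0.
rewrite -mulr_natl => lnt.
have p0 : 0 <= p%:R :> R by [].
have := ler_wpM2l p0 lnt; rewrite mulrN => lnt' opt.
have : (1 - t) * frob A S <= p%:R * (t^-1 - 1) by lra.
have -> : p%:R * (t^-1 - 1) = (1 - t) * (p%:R * t^-1).
  by field; rewrite gt_eqF.
by rewrite ler_pM2l ?subr_gt0// ler_pdivlMr// mulr1 mulrC.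
Qed.

(** Comparing A with A + t B gives det (1 + t A^-1 B) <= exp (t <B, S>). By [det_unitD] the left
    side is at least 1 + t c - t^2 K, and the terms of first order in t are compared. *)
Lemma mle_frob_inv_le p (S A B : 'M[R]_p) : is_mle S A -> Mset B ->
  frob B (invmx A) <= frob B S.
Proof.
move=> mleA BM; have A0 := mle_det_gt0 mleA; move: mleA => [AM Amin].
have Au : A \in unitmx by rewrite unitmxE unitfE gt_eqF.
set c := frob B (invmx A); set b := frob B S.
have [K K0 detK] := det_unitD (invmx A *m B).
have trE : \tr (invmx A *m B) = c by rewrite /c /frob BM.1.1 mxtrace_mulC.
have H t : 0 < t <= 1 -> 1 + t * c - t ^+ 2 * K <= expR (t * b).
  move=> /[dup] /andP[t0 t1] t01;
  apply: le_trans (_ : _ <= \det (1%:M + t *: (invmx A *m B))) _.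
    by rewrite -trE detK.
  set D := \det _.
  have [D0|D0] := leP D 0; first exact: le_trans D0 (expR_ge0 _).
  have ABE : A + t *: B = A *m (1%:M + t *: (invmx A *m B)).
    by rewrite mulmxDr mulmx1 -scalemxAr mulKVmx.
  have := Amin _ (MsetD AM (MsetZ (ltW t0) BM)).
  have detE : \det (A + t *: B) = \det A * D by rewrite ABE det_mulmx.
  rewrite !mle_objectiveE// detE ?mulr_gt0// lee_fin frobDl frobZl lnM ?posrE//.
  move=> opt; rewrite -[leLHS]lnK ?posrE// ler_expR -/b; lra.
rewrite leNgt; apply/negP => bc.
pose d := c - b; have d0 : 0 < d by rewrite subr_gt0.
(* [M] is large enough that t = d / M satisfies t <= 1 and t |b| < 1, and exceeds the second-order
   coefficient K + c b - t K b. *)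
pose M := 1 + d + K + `|c * b| + K * `|b| + d * `|b|.
have cb0 := normr_ge0 (c * b); have b0 := normr_ge0 b.
have Kb0 : 0 <= K * `|b| by rewrite mulr_ge0.
have db0 : 0 <= d * `|b| by rewrite mulr_ge0// ltW.
have M0 : 0 < M by rewrite /M; lra.
pose t := d / M.
have t0 : 0 < t by rewrite divr_gt0.
have tM : t * M = d by rewrite /t divfK// gt_eqF.
have t1 : t <= 1 by rewrite ler_pdivrMr// mul1r /M; lra.
have tb1 : t * `|b| < 1.
  by rewrite /t mulrAC ltr_pdivrMr// mul1r /M; lra.
have := H t; rewrite t0 t1 => /(_ isT) Ht.
have tb : t * b < 1 by apply: le_lt_trans tb1; rewrite ler_wpM2l ?ler_norm// ltW.
(* The factor 1 - t b <= exp (- t b) removes the exponential. *)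
have : (1 + t * c - t ^+ 2 * K) * (1 - t * b) <= 1.
  apply: (@le_trans _ _ (expR (t * b) * (1 - t * b))).
    by rewrite ler_wpM2r// subr_ge0 ltW.
  rewrite -(@ler_pM2l _ (expR (- (t * b)))) ?expR_gt0// mulr1 mulrA -expRD addNr.
  by rewrite expR0 mul1r; exact: expR_ge1Dx.
have -> : (1 + t * c - t ^+ 2 * K) * (1 - t * b) =
  1 + t * (d - t * (K + c * b - t * K * b)) by rewrite /d; ring.
rewrite gerDl pmulr_rle0// subr_le0.
apply/negP; rewrite -ltNge -tM ltr_pM2l// /M.
have := ler_norm (c * b); have : - (t * K * b) <= K * `|b|; last by lra.
apply: le_trans (ler_norm _) _; rewrite normrN normrM normrM.
rewrite (ger0_norm K0) (ger0_norm (ltW t0)) -mulrA ler_piMl// mulr_ge0//.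
Qed.

(** * Existence of the maximum likelihood estimator *)

Lemma continuous_bigsum (V : topologicalType) (I : Type) (r : seq I) (P : pred I)
    (f : I -> V -> R) : (forall i, continuous (f i)) ->
  continuous (fun v => \sum_(i <- r | P i) f i v).
Proof.
move=> fc; elim: r => [|i r IH].
  under eq_fun do rewrite big_nil; exact: cst_continuous.
under eq_fun do rewrite big_cons.
by case: (P i) => // v; apply: cvgD; [exact: fc|exact: IH].
Qed.

Lemma continuous_bigprod (V : topologicalType) (I : Type) (r : seq I) (P : pred I)
    (f : I -> V -> R) : (forall i, continuous (f i)) ->
  continuous (fun v => \prod_(i <- r | P i) f i v).
Proof.
move=> fc; elim: r => [|i r IH].
  under eq_fun do rewrite big_nil; exact: cst_continuous.
under eq_fun do rewrite big_cons.
by case: (P i) => // v; apply: cvgM; [exact: fc|exact: IH].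
Qed.

Lemma continuous_mulr (V : topologicalType) (f g : V -> R) :
  continuous f -> continuous g -> continuous (fun v => f v * g v).
Proof. by move=> fc gc v; apply: cvgM; [exact: fc|exact: gc]. Qed.

Lemma continuous_subr (V : topologicalType) (f g : V -> R) :
  continuous f -> continuous g -> continuous (fun v => f v - g v).
Proof. by move=> fc gc v; apply: cvgB; [exact: fc|exact: gc]. Qed.

Lemma closed_fun_ge0 (V : topologicalType) (f : V -> R) : continuous f ->
  closed [set v | 0 <= f v].
Proof.
move=> fc; apply: (@preimage_closed _ _ f [set x | 0 <= x]); last exact: closed_ge.
by move=> x _; exact: fc.
Qed.

(* By homogeneity the minimum is attained where <A, S> <= p, on which the
   determinant is to be maximized. *)
Lemma mle_exists p (S : 'M[R]_p) (a : R) : (0 < p)%N -> 0 < a ->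
  (forall B, Mset B -> a * \tr B <= frob B S) -> exists A, is_mle S A.
Proof.
move=> p0 a0 coer.
pose F (v : 'rV[R]_(p * p)) : 'M[R]_p := vec_mx v.
have Fc j k : continuous (fun v => F v j k).
  by move=> v; rewrite /F; under eq_fun do rewrite mxE; exact: coord_continuous.
pose K := [set v | Mset (F v) /\ frob (F v) S <= p%:R].
have pR0 : 0 < p%:R :> R by rewrite ltr0n.
have Kcl : closed K.
  (* Every constraint is put in the form 0 <= f with f continuous. Symmetry is the pair of
     inequalities indexed by (j, k) and (k, j), and the factor (j != k) makes the sign constraint
     vacuous on the diagonal. *)
  have -> : K = [set v | 0 <= p%:R - frob (F v) S] `&`
     (\bigcap_(jk in [set: 'I_p * 'I_p])
        ([set v | 0 <= F v jk.1 jk.2 - F v jk.2 jk.1] `&`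
         [set v | 0 <= (jk.1 != jk.2)%:R * - F v jk.1 jk.2])) `&`
     \bigcap_(u in [set: 'cV[R]_p]) [set v | 0 <= quadform (F v) u].
    apply/seteqP; split => v.
      move=> [[Fpsd Fo] FS]; split; [split|].
      - by rewrite /= subr_ge0.
      - move=> [j k] _; split => /=; first by rewrite (psd_sym Fpsd) subrr.
        by case: eqVneq => [_|/Fo]; rewrite ?mul0r// mul1r oppr_ge0.
      - by move=> u _; exact: Fpsd.2.
    move=> [[/= FS Fs] Fq]; split; last by rewrite -subr_ge0.
    split; first split.
    - apply/matrixP => j k; rewrite mxE.
      by have [/= ? _] := Fs (j, k) I; have [/= ? _] := Fs (k, j) I; lra.
    - by move=> u; exact: Fq.
    - move=> j k jk; have [_ /=] := Fs (j, k) I.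
      by rewrite jk mul1r oppr_ge0.
  apply: closedI; [apply: closedI|].
  - apply: closed_fun_ge0; apply: continuous_subr; first exact: cst_continuous.
    under eq_fun do rewrite frobE.
    apply: continuous_bigsum => j; apply: continuous_bigsum => k.
    by apply: continuous_mulr; [exact: Fc|exact: cst_continuous].
  - apply: closed_bigI => -[j k] _; apply: closedI; apply: closed_fun_ge0 => /=.
      by apply: continuous_subr; exact: Fc.
    apply: continuous_mulr; first exact: cst_continuous.
    under eq_fun do rewrite -sub0r.
    by apply: continuous_subr; [exact: cst_continuous|exact: Fc].
  - apply: closed_bigI => u _; apply: closed_fun_ge0.
    under eq_fun do rewrite quadformE.
    apply: continuous_bigsum => j; apply: continuous_bigsum => k.
    by apply: continuous_mulr; [exact: Fc|exact: cst_continuous].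
have Kbd : bounded_set K.
  exists (p%:R / a); split; first exact: num_real.
  move=> M hM v [Fv FvS]; rewrite /= (mx_normrE v : `|v| = _).
  apply/bigmax_leP; split.
    by rewrite ltW// (le_lt_trans _ hM)// divr_ge0// ltW.
  move=> [i k] _ /=; rewrite (ord1 i) {i}; case/mxvec_indexP: k => j k.
  have -> : v 0 (mxvec_index j k) = F v j k by rewrite /F mxE.
  apply: le_trans (psd_entry_le _ _ Fv.1) _; apply: le_trans (ltW hM).
  by rewrite ler_pdivlMr// mulrC (le_trans (coer _ Fv)).
have trM0 B : Mset B -> 0 < \det B -> 0 < frob B S.
  move=> BM B0; apply: lt_le_trans (coer _ BM); rewrite mulr_gt0//.
  rewrite lt_def (le_trans (normr_ge0 _) (psd_entry_le (Ordinal p0) (Ordinal p0) BM.1)).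
  rewrite andbT; apply: contraTneq B0 => tr0.
  have -> : B = 0.
    apply/matrixP => j k; rewrite mxE; apply/eqP.
    by rewrite -normr_le0 -tr0 psd_entry_le//; exact: BM.1.
  by rewrite -(scale0r 1%:M) detZ expr0n gtn_eqF// mul0r ltxx.
(* Rescaling to <B, S> = p brings every nonsingular competitor into [K]. *)
pose sc B := (p%:R / frob B S) *: B.
have scK B : Mset B -> 0 < \det B ->
    K (mxvec (sc B)) /\ \det (sc B) = (p%:R / frob B S) ^+ p * \det B.
  move=> BM B0; have b0 := trM0 _ BM B0.
  rewrite /K /F /= mxvecK; split; last by rewrite detZ.
  split; first by apply: MsetZ => //; rewrite divr_ge0// ltW.
  by rewrite frobZl divfK// gt_eqF.
have [] := @compact_EVT_max _ R (fun v => \det (F v)) K.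
- by have [K1 _] := scK _ (Mset1 _) ltac:(by rewrite det1); exists (mxvec (sc 1%:M)).
- exact: bounded_closed_compact.
- apply: continuous_subspaceT.
  rewrite /determinant; apply: continuous_bigsum => s.
  apply: continuous_mulr; first exact: cst_continuous.
  exact: continuous_bigprod.
move=> v /set_mem [FvM FvS] vmax.
have maxD B : Mset B -> 0 < \det B ->
    (p%:R / frob B S) ^+ p * \det B <= \det (F v).
  move=> BM B0; have [BK <-] := scK _ BM B0.
  by have := vmax _ (mem_set BK); rewrite /F mxvecK.
have F0 : 0 < \det (F v).
  apply: lt_le_trans (maxD _ (Mset1 _) _); rewrite det1// mulr1 exprn_gt0//.
  by rewrite divr_gt0// trM0 ?det1//; exact: Mset1.
exists (F v); split => // B BM.
have := det_psd_ge0 BM.1; rewrite le_eqVlt => /predU1P[B0|B0].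
  by rewrite {2}/mle_objective /neg_log_det -B0 eqxx addey// leey.
rewrite !mle_objectiveE// lee_fin.
have b0 := trM0 _ BM B0; have pb0 : 0 < p%:R / frob B S by rewrite divr_gt0.
have := maxD _ BM B0; rewrite -ler_ln ?posrE ?mulr_gt0 ?exprn_gt0//.
rewrite lnM ?posrE ?exprn_gt0// lnXn//.
(* With - ln x <= 1/x - 1 at x = p / <B, S>, maximality of the determinant on [K] gives - ln det (F
   v) <= <B, S> - p - ln det B, while <F v, S> <= p. *)
have : - ln (p%:R / frob B S) <= frob B S / p%:R - 1.
  rewrite -lnV ?posrE// invf_div; have := @le_ln1Dx R (frob B S / p%:R - 1).
  rewrite (addrC 1) subrK ltrBrDl subrr; apply; exact: divr_gt0.
move=> /(ler_wpM2l (ltW pR0)); rewrite mulrBr mulr1 mulrCA divff ?gt_eqF// mulr1.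
rewrite -mulr_natl mulrN; lra.
Qed.

End Mle.

(** * Chi-square concentration *)

Section Integration.
Context {R : realType}.
Local Open Scope ereal_scope.
Import HBNNSimple.

(** Linearity extends the identity from indicators to simple functions, monotone convergence to
    nonnegative functions. It serves both to replace one factor of a product and to integrate
    against a density. *)
Lemma ge0_integral_weighted d d' (T : measurableType d) (T' : measurableType d')
    (P : {measure set T -> \bar R}) (mu : {measure set T' -> \bar R})
    (Z : T -> T') (g : T -> R) (c : R) :
  measurable_fun setT Z -> measurable_fun setT g -> (forall w, 0 <= g w)%R ->
  (forall B, measurable B -> \int[P]_w (\1_B (Z w) * g w)%:E = c%:E * mu B) ->
  forall f : T' -> R, measurable_fun setT f -> (forall x, 0 <= f x)%R ->
  \int[P]_w (f (Z w) * g w)%:E = c%:E * \int[mu]_x (f x)%:E.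
Proof.
move=> mZ mg g0 Hind f mf f0.
have mf' : measurable_fun [set: T'] (EFin \o f) by exact/measurable_EFinP.
pose f_ := nnsfun_approx measurableT mf'.
have step (h : {nnsfun T' >-> R}) :
    \int[P]_w (h (Z w) * g w)%:E = c%:E * \int[mu]_x (h x)%:E.
  have mind r : measurable_fun setT (fun w => \1_(h @^-1` [set r]) (Z w) : R).
    by apply: measurableT_comp => //; exact: measurable_indic.
  transitivity (\sum_(r \in range h)
      \int[P]_w (r%:E * (\1_(h @^-1` [set r]) (Z w) * g w)%:E)).
    rewrite -ge0_integral_fsum//; last 2 first.
    - move=> r; apply/measurable_EFinP; apply: measurable_funM => //.
      exact: measurable_funM.
    - move=> r w _; rewrite -EFinM mulrA lee_fin mulr_ge0//.
      by have := nnfun_muleindic_ge0 h r (Z w); rewrite lee_fin.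
    apply: eq_integral => w _; rewrite fimfunE.
    rewrite !fsbig_finite//= mulr_suml -sumEFin.
    by apply: eq_bigr => r _; rewrite -EFinM mulrA.
  transitivity (\sum_(r \in range h) c%:E * (r%:E * mu (h @^-1` [set r]))).
    apply: eq_fsbigr => r /[!inE] -[x _ <-].
    rewrite ge0_integralZl//; last 3 first.
    - by apply/measurable_EFinP; exact: measurable_funM.
    - by move=> w _; rewrite lee_fin mulr_ge0.
    - by rewrite lee_fin.
    by rewrite Hind// muleCA.
  rewrite -ge0_mule_fsumr; last first.
    (* A negative r is not a value of h, so its preimage is empty. *)
    move=> r; have := nnfun_muleindic_ge0 h r.
    have [r0|r0] := leP 0%R r; first by move=> _; rewrite mule_ge0// lee_fin.
    move=> _; rewrite preimage_nnfun0// measure0 mule0//.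
  congr (c%:E * _).
  under [RHS]eq_integral do rewrite fimfunE -fsumEFin//.
  rewrite [RHS]ge0_integral_fsum//; last 2 first.
    - by move=> r; exact/measurable_EFinP/measurable_funM.
    - by move=> n x _; rewrite nnfun_muleindic_ge0.
  apply: eq_fsbigr => r _.
  by rewrite integralZl_indic_nnsfun// integral_indic// setIT.
transitivity (limn (fun n => \int[P]_w (f_ n (Z w) * g w)%:E)).
  rewrite -monotone_convergence//=.
  - apply: eq_integral => w _; apply/esym/cvg_lim => //=.
    under eq_fun do rewrite EFinM.
    rewrite EFinM; apply: cvgeM => //=; last 2 first.
    + apply: (cvg_nnsfun_approx measurableT mf') => //= x _.
      by rewrite lee_fin.
    + exact: cvg_cst.
  - move=> n; apply/measurable_EFinP; apply: measurable_funM => //.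
    by apply: measurableT_comp.
  - by move=> n x _; rewrite lee_fin mulr_ge0.
  - move=> x _ a b ab; rewrite lee_fin ler_wpM2r//.
    exact/lefP/nd_nnsfun_approx.
rewrite (_ : \int[mu]_x _ = limn (fun n => \int[mu]_x (f_ n x)%:E)); last first.
  rewrite -monotone_convergence//=.
  - apply: eq_integral => x _; apply/esym/cvg_lim => //.
    apply: (cvg_nnsfun_approx measurableT mf') => //= y _.
    by rewrite lee_fin.
  - by move=> n; exact/measurable_EFinP.
  - by move=> n x _; rewrite lee_fin.
  - by move=> x _ a b ab; rewrite lee_fin//; exact/lefP/nd_nnsfun_approx.
rewrite -limeMl//.
  by congr (limn _); apply/funext => n /=; rewrite step.
apply/ereal_nondecreasing_is_cvgn => a b ab; apply: ge0_le_integral => //.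
- by move=> x _; rewrite lee_fin.
- exact/measurable_EFinP.
- exact/measurable_EFinP.
- by move=> x _; rewrite lee_fin; exact/lefP/nd_nnsfun_approx.
Qed.

Lemma integral_prod_indep n d (T : measurableType d) (P : probability T R)
    (nu : probability (measurableTypeR R) R) (Z : 'I_n -> T -> R) :
  (forall i, measurable_fun setT (Z i)) ->
  (forall B : 'I_n -> set R, (forall i, measurable (B i)) ->
    P [set w | forall i, B i (Z i w)] = \prod_(i < n) nu (B i)) ->
  forall (h : 'I_n -> R -> R) (I : 'I_n -> R),
  (forall i, measurable_fun setT (h i)) -> (forall i x, 0 <= h i x)%R ->
  (forall i, \int[nu]_x (h i x)%:E = (I i)%:E) ->
  \int[P]_w (\prod_(i < n) h i (Z i w))%:E = (\prod_(i < n) I i)%:E.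
Proof.
move=> mZ indep.
(* The indicators of the product rule are replaced by the h i one at a time. *)
suff claim k : forall (h : 'I_n -> R -> R) (I : 'I_n -> R),
    (forall i, measurable_fun setT (h i)) -> (forall i x, 0 <= h i x)%R ->
    (forall i, \int[nu]_x (h i x)%:E = (I i)%:E) ->
    (forall i : 'I_n, (k <= i)%N -> exists B, measurable B /\ h i = \1_B) ->
    \int[P]_w (\prod_(i < n) h i (Z i w))%:E = (\prod_(i < n) I i)%:E.
  move=> h I mh h0 hI; apply: (claim n) => // i.
  by rewrite leqNgt ltn_ord.
elim: k => [|k IH] h I mh h0 hI hind.
  have /choice[B HB] : forall i, exists B, measurable B /\ h i = \1_B.
    by move=> i; exact: hind.
  pose A := [set w | forall i, B i (Z i w)].
  have mA : measurable A.
    have -> : A = \bigcap_(i in [set: 'I_n]) (Z i @^-1` B i).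
      by apply/seteqP; split => w /= Aw i *; exact: Aw.
    apply: fin_bigcap_measurable; first exact: finite_finset.
    by move=> i _; rewrite -[X in measurable X]setTI; apply: mZ => //; case: (HB i).
  transitivity (\int[P]_w (\1_A w : R)%:E).
    apply: eq_integral => w _; congr (_%:E); rewrite indicE.
    have [wA|wA] := boolP (w \in A).
      rewrite big1// => i _; rewrite (HB i).2 indicE mem_set//.
      by move/set_mem: wA; apply.
    have /existsNP[i Bi] : ~ forall i, B i (Z i w) by move=> wA'; rewrite mem_set in wA.
    by rewrite (bigD1 i)//= (HB i).2 indicE memNset// mul0r.
  rewrite integral_indic// setIT; transitivity (\prod_(i < n) nu (B i)).
    by apply: indep => i; case: (HB i).
  rewrite -prodEFin; apply: eq_bigr => i _.
  by rewrite -hI (HB i).2 integral_indic ?setIT//; case: (HB i).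
have [kn|nk] := ltnP k n; last first.
  apply: IH => // i ki; move: (ltn_ord i); rewrite ltnNge (leq_trans nk)//.
pose i0 := Ordinal kn.
pose g w := (\prod_(i < n | i != i0) h i (Z i w))%R.
have mg : measurable_fun setT g.
  have -> : g = fun w => (\prod_(i <- [seq i <- index_enum 'I_n | i != i0])
      h i (Z i w))%R by apply/funext => w; rewrite big_filter.
  by apply: measurable_prod => i _; exact: measurableT_comp.
transitivity (\int[P]_w (h i0 (Z i0 w) * g w)%:E).
  by apply: eq_integral => w _; rewrite (bigD1 i0).
rewrite (bigD1 i0)//= mulrC EFinM -hI.
apply: ge0_integral_weighted; [exact: mZ|by []| | |exact: mh|by []].
  by move=> w; rewrite /g prodr_ge0.
move=> B mB.
(* With the indicator of B in place of [h i0], the previous stage applies; [ge0_integral_weighted]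
   with weight [g] then puts [h i0] back. *)
pose h' i := if i == i0 then \1_B else h i.
pose I' i := if i == i0 then fine (nu B) else I i.
have := IH h' I'.
have nuB : nu B = (fine (nu B))%:E by rewrite fineK// fin_num_measure.
rewrite [X in _ -> _ -> _ -> _ -> _ = X%:E](bigD1 i0)//= /I' eqxx.
rewrite (eq_bigr I); last by move=> i /negbTE ->.
rewrite mulrC EFinM -nuB => <-.
- apply: eq_integral => w _; rewrite (bigD1 i0)//= /h' eqxx; congr (_ * _)%:E.
  by apply: eq_bigr => i /negbTE ->.
- by move=> i; rewrite /h'; case: ifP => // _; exact: measurable_indic.
- by move=> i x; rewrite /h'; case: ifP.
- by move=> i; rewrite /h'; case: ifP => // _; rewrite integral_indic ?setIT.
- move=> i ki; rewrite /h'; case: eqVneq => [_|ii0]; first by exists B.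
  apply: hind; rewrite ltn_neqAle ki andbT.
  by apply: contra ii0 => /eqP ki'; apply/eqP/val_inj.
Qed.

(** The exponential factor turns the N(0, s^2) density into (1 - x)^(-1/2) times the N(0, s^2 / (1 -
    x)) density, which has mass 1. *)
Lemma normal_mgf_sqr (s x : R) : (0 < s)%R -> (x < 1)%R ->
  \int[normal_prob 0 s]_z (expR (x * z ^+ 2 / (s ^+ 2 *+ 2)))%:E =
  ((Num.sqrt (1 - x))^-1)%:E.
Proof.
move=> s0 x1.
have x10 : (0 < 1 - x)%R by rewrite subr_gt0.
pose f z : R := expR (x * z ^+ 2 / (s ^+ 2 *+ 2)).
have mf : measurable_fun setT f.
  apply: measurableT_comp => //; apply: measurable_funM => //.
  by apply: measurable_funM => //; exact: measurable_funX.
have sn0 : (s != 0)%R by rewrite gt_eqF.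
pose s' := (s / Num.sqrt (1 - x))%R.
have s'0 : (0 < s')%R by rewrite divr_gt0// sqrtr_gt0.
rewrite -[LHS]mul1e.
rewrite -(@ge0_integral_weighted _ _ (measurableTypeR R) (measurableTypeR R)
  lebesgue_measure (normal_prob 0 s) idfun (normal_pdf 0 s) 1)//.
- transitivity (\int[lebesgue_measure]_z
     (((Num.sqrt (1 - x))^-1)%:E * (normal_pdf 0 s' z)%:E)).
    apply: eq_integral => z _; rewrite -EFinM; congr (_%:E).
    rewrite !normal_pdfE ?gt_eqF// /normal_peak /normal_fun.
    rewrite mulrCA -expRD [RHS]mulrA; congr (_ * expR _)%R.
      have -> : (s ^+ 2 * pi *+ 2 = (1 - x) * (s' ^+ 2 * pi *+ 2))%R.
        rewrite /s' expr_div_n sqr_sqrtr ?ltW//; field.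
        by rewrite gt_eqF.
      by rewrite sqrtrM ?invfM ?ltW.
    rewrite /= /s' expr_div_n sqr_sqrtr ?ltW//; field.
    by rewrite sn0 gt_eqF.
  rewrite ge0_integralZl_EFin//.
  + by rewrite integral_normal_pdf mule1.
  + by move=> z _; rewrite lee_fin normal_pdf_ge0.
  + by apply/measurable_EFinP; exact: measurable_normal_pdf.
- exact: measurable_id.
- exact: measurable_normal_pdf.
- by move=> z; exact: normal_pdf_ge0.
- move=> B mB; rewrite mul1e /normal_prob [RHS]integral_mkcond.
  apply: eq_integral => z _; rewrite /patch indicE.
  by case: ifP => _; rewrite ?mul1r ?mul0r.
Qed.

(** With v = 1 + (x + x^2) / 2 <= exp ((x + x^2) / 2), it suffices that (1 - x) v^2 >= 1. The
    bracket multiplying x^2 in its expansion is at least (7/8)^3 / 4 - 1/8 > 0. *)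
Lemma sqrtV_le_expR (x : R) : (- 8^-1 <= x <= 8^-1)%R ->
  ((Num.sqrt (1 - x))^-1 <= expR ((x + x ^+ 2) / 2))%R.
Proof.
move=> /andP[xl xu].
have x10 : (0 < 1 - x)%R by lra.
have r0 : (0 < Num.sqrt (1 - x))%R by rewrite sqrtr_gt0.
have r2 := sqr_sqrtr (ltW x10).
apply: le_trans (expR_ge1Dx _).
rewrite -[leLHS]mul1r ler_pdivrMr//.
set r := Num.sqrt _ in r0 r2 *; set v := (1 + _)%R.
have v0 : (0 < v)%R by rewrite /v; nra.
rewrite -(@ler_pXn2r _ 2) ?nnegrE ?mulr_ge0 ?(ltW v0) ?(ltW r0)// expr1n exprMn r2.
have -> : (v ^+ 2 * (1 - x) = 1 + x ^+ 2 * ((1 - x) * (1 + x) ^+ 2 / 4 - x))%R.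
  by rewrite /v; field.
rewrite lerDl mulr_ge0 ?sqr_ge0// subr_ge0.
have : (7/8 <= 1 - x)%R by lra.
have : (7/8 <= 1 + x)%R by lra.
nra.
Qed.

Section ChiSquareTail.
Context (n : nat) (d : measure_display) (T : measurableType d).
Context (P : probability T R) (Z : 'I_n -> T -> R) (s : R).
Context (mZ : forall i, measurable_fun setT (Z i)) (s0 : (0 < s)%R).
Context (indep : forall B : 'I_n -> set R, (forall i, measurable (B i)) ->
  P [set w | forall i, B i (Z i w)] = \prod_(i < n) normal_prob 0 s (B i)).

Lemma measurable_sum_sqr : measurable_fun setT (fun w => \sum_(i < n) Z i w ^+ 2)%R.
Proof. by apply: measurable_sum => i; exact: measurable_funX. Qed.

(* Both tails at once: x > 0 gives the upper tail and x < 0 the lower one. *)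
Lemma chi_square_chernoff (x : R) : (- 8^-1 <= x <= 8^-1)%R ->
  P [set w | x * (n%:R * (1 + 2 * x) * s ^+ 2) <=
             x * \sum_(i < n) Z i w ^+ 2]%R
  <= (expR (- (n%:R * x ^+ 2 / 2)))%:E.
Proof.
move=> x8.
have s20 : (0 < s ^+ 2 *+ 2)%R by rewrite pmulrn_lgt0// exprn_gt0.
pose W w := (x * (\sum_(i < n) Z i w ^+ 2) / (s ^+ 2 *+ 2))%R.
have mW : measurable_fun setT W.
  apply: measurable_funM => //; apply: measurable_funM => //.
  exact: measurable_sum_sqr.
pose WR : {RV P >-> R} := HB.pack W (isMeasurableFun.Build _ _ _ _ _ mW).
pose a := (x * (n%:R * (1 + 2 * x) * s ^+ 2) / (s ^+ 2 *+ 2))%R.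
have aE : (a = n%:R * (x * (1 + 2 * x) / 2))%R.
  by rewrite /a; field; rewrite gt_eqF.
have -> : [set w | x * (n%:R * (1 + 2 * x) * s ^+ 2) <=
             x * \sum_(i < n) Z i w ^+ 2]%R = [set w | WR w >= a]%R.
  by apply/seteqP; split => w /=; rewrite /W /a ler_pM2r// invr_gt0.
(* The Chernoff parameter is 1 because x is already a factor of [W], whatever its sign. *)
apply: le_trans (chernoff _ _ (ltr01 : 0 < 1)%R) _.
have -> : 'M_P WR 1 = ((Num.sqrt (1 - x))^-1 ^+ n)%:E.
  rewrite /mmt_gen_fun unlock.
  transitivity (\int[P]_w (\prod_(i < n) expR (x * Z i w ^+ 2 / (s ^+ 2 *+ 2)))%:E).
    apply: eq_integral => w _; congr (_%:E) => /=; rewrite mulr1 /W.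
    by rewrite mulr_sumr mulr_suml expR_sum.
  rewrite (integral_prod_indep (nu := normal_prob 0 s) mZ indep
    (h := fun _ z => expR (x * z ^+ 2 / (s ^+ 2 *+ 2)))
    (I := fun=> (Num.sqrt (1 - x))^-1)%R).
  - by rewrite prodr_const card_ord.
  - move=> _; apply: measurableT_comp => //; apply: measurable_funM => //.
    by apply: measurable_funM => //; exact: measurable_funX.
  - by move=> _ z; exact: expR_ge0.
  - by move=> _; apply: normal_mgf_sqr => //; lra.
rewrite -EFinM lee_fin mul1r.
apply: (@le_trans _ _ (expR ((x + x ^+ 2) / 2) ^+ n * expR (- a))%R).
  rewrite ler_wpM2r ?expR_ge0// lerXn2r ?nnegrE ?expR_ge0 ?invr_ge0 ?sqrtr_ge0//.
  exact: sqrtV_le_expR.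
(* The threshold 1 + 2 x leaves the exponent (x + x^2) / 2 - x (1 + 2 x) / 2 = - x^2 / 2 per
   variable. *)
rewrite -expRM_natr -expRD ler_expR aE le_eqVlt; apply/orP; left; apply/eqP.
by field.
Qed.

(** The Chernoff bound is taken at x = eps / 2 and x = - eps / 2, for which 1 + 2 x is 1 + eps and 1
    - eps; eps <= 1/4 is the condition |x| <= 1/8. *)
Lemma chi_square_tail (eps : R) : (0 < eps <= 4^-1)%R -> (0 < n)%N ->
  P [set w | eps * s ^+ 2 < `|n%:R^-1 * (\sum_(i < n) Z i w ^+ 2) - s ^+ 2|]%R
  <= (2 * expR (- (n%:R * eps ^+ 2 / 8)))%:E.
Proof.
move=> /andP[e0 e4] n0.
have nR0 : (0 < n%:R :> R)%R by rewrite ltr0n.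
pose A x := [set w | x * (n%:R * (1 + 2 * x) * s ^+ 2) <=
             x * \sum_(i < n) Z i w ^+ 2]%R.
have mA x : measurable (A x).
  rewrite -[A x]setTI.
  have := @measurable_funM _ _ R setT (cst x) _ (measurable_cst _) measurable_sum_sqr.
  move=> /(_ measurableT `[(x * (n%:R * (1 + 2 * x) * s ^+ 2))%R, +oo[%classic).
  move=> /(_ (measurable_itv _)); congr (measurable (_ `&` _)).
  by apply/seteqP; split => w /=; rewrite in_itv/= andbT.
apply: (@le_trans _ _ (P (A (eps / 2) `|` A (- (eps / 2)))))%R.
  apply: le_measure; rewrite ?inE.
  - have mq : measurable_fun setT
        (fun w => `|n%:R^-1 * (\sum_(i < n) Z i w ^+ 2) - s ^+ 2|)%R.
      apply: measurableT_comp => //; apply: measurable_funB => //.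
      by apply: measurable_funM => //; exact: measurable_sum_sqr.
    move: (mq measurableT `](eps * s ^+ 2)%R, +oo[%classic (measurable_itv _)).
    rewrite setTI; congr (measurable _).
    by apply/seteqP; split => w /=; rewrite in_itv/= andbT.
  - exact: measurableU.
  - move=> w /=; set V := (\sum_(i < n) _)%R.
    have VE : V = (n%:R * (n%:R^-1 * V))%R by rewrite mulrA divff ?mul1r ?gt_eqF.
    set q := (n%:R^-1 * V)%R in VE *; rewrite /A /= -/V VE.
    rewrite -!(mulrA n%:R) ![(_ * (n%:R * _))%R]mulrCA !(ler_pM2l nR0).
    rewrite ltr_normr => /orP[h|h]; [left|right].
    + rewrite ler_pM2l ?divr_gt0//; lra.
    + rewrite !mulNr lerN2 ler_pM2l ?divr_gt0//; lra.
apply: le_trans (measureU2 _ _ _) _ => //.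
have le8 : (- 8^-1 <= eps / 2 <= 8^-1)%R by lra.
have le8' : (- 8^-1 <= - (eps / 2) <= 8^-1)%R by lra.
apply: le_trans (leeD (chi_square_chernoff le8) (chi_square_chernoff le8')) _.
rewrite -EFinD lee_fin sqrrN.
have -> : (n%:R * (eps / 2) ^+ 2 / 2 = n%:R * eps ^+ 2 / 8)%R by field.
by lra.
Qed.

End ChiSquareTail.

End Integration.

(** * The loss on the good event *)

Section Deterministic.
Context {R : realType}.

Lemma frob_invmx p (A : 'M[R]_p) : A \in unitmx -> (invmx A)^T = invmx A ->
  frob (invmx A) A = p%:R.
Proof. by move=> Au At; rewrite /frob At mulVmx// mxtrace1. Qed.

Lemma ssym_loss_le p (Sigma S Theta : 'M[R]_p) (d : 'I_p -> R) (kappa eps : R) :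
  (0 < p)%N -> posdef Sigma -> Mset (invmx Sigma) -> is_mle S Theta ->
  (forall j, Sigma j j = d j ^+ 2) ->
  (forall j k, j != k -> Sigma j k <= (1 - kappa) * (d j * d k)) ->
  0 < kappa <= 1 -> 0 <= eps <= kappa / 4 ->
  (forall j k, `|(S - Sigma) j k| <= eps * (d j * d k)) ->
  ssym_loss Theta (invmx Sigma) <= 3 * eps / kappa.
Proof.
move=> p0 Spd SM mleT Sd So /andP[k0 k1] /andP[e0 e4] SE.
have pR0 : 0 < p%:R :> R by rewrite ltr0n.
have SU := posdef_unit Spd.
have TM := mleT.1.
have TU : Theta \in unitmx by rewrite unitmxE unitfE gt_eqF// (mle_det_gt0 mleT).
pose wsum (B : 'M[R]_p) := \sum_j B j j * d j ^+ 2.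
have Tstar : kappa * wsum (invmx Sigma) <= p%:R.
  have := @frob_ge R p Sigma (invmx Sigma) d kappa 0 SM.
  rewrite frob_invmx//; last exact: SM.1.1.
  rewrite mulr0 subr0 addr0 subr0; apply.
  - by move=> j; rewrite mul1r Sd.
  - by move=> j k jk; exact: So.
  - by rewrite subr_ge0.
have That : kappa * wsum Theta <= 2 * p%:R.
  have wT0 : 0 <= wsum Theta.
    by apply: sumr_ge0 => j _; rewrite mulr_ge0 ?sqr_ge0// psd_diag_ge0//; exact: TM.1.
  have : (kappa - 2 * eps) * wsum Theta <= p%:R.
    apply: le_trans (mle_frob_le mleT); apply: frob_ge => //; last by lra.
    - move=> j; have := SE j j; rewrite !mxE Sd ler_norml => /andP[h _]; lra.
    - move=> j k jk; have := SE j k; have := So j k jk.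
      rewrite !mxE ler_norml => h1 /andP[_ h2]; lra.
  (* Here eps <= kappa / 4 keeps half of the gap. *)
  have : (kappa / 2) * wsum Theta <= (kappa - 2 * eps) * wsum Theta.
    by apply: ler_wpM2r => //; lra.
  lra.
have FT : frob Theta (invmx Theta) = p%:R.
  by rewrite /frob TM.1.1 mulmxV// mxtrace1.
have FS := frob_invmx SU SM.1.1.
have L1 := mle_frob_inv_le mleT SM.
have L2 := mle_frob_le mleT.
have D1 := frob_le TM SE e0; have D2 := frob_le SM SE e0.
rewrite -/(wsum Theta) in D1; rewrite -/(wsum (invmx Sigma)) in D2.
rewrite /ssym_loss invmxK frobBl !frobBr FT FS.
rewrite !frobBr FS in D1 D2.
rewrite ler_pdivlMr// -mulrA ler_pdivrMl ?mulr_gt0//.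
move: D1 D2; rewrite !ler_norml => /andP[D1 D1'] /andP[D2 D2'].
have num : frob Theta Sigma - p%:R - (p%:R - frob (invmx Sigma) (invmx Theta))
   <= 2 * eps * (wsum Theta + wsum (invmx Sigma)) by lra.
have := ler_wpM2r (ltW k0) num; move/le_trans; apply.
have : eps * (kappa * wsum (invmx Sigma) + kappa * wsum Theta) <= eps * (3 * p%:R).
  by apply: ler_wpM2l => //; lra.
lra.
Qed.

(** The estimator is only known to be a minimizer where one exists, so existence is established on
    the good event: there [frob_ge] gives the coercivity required by [mle_exists]. *)
Lemma mle_exists_near p (Sigma S : 'M[R]_p) (d : 'I_p -> R) (kappa eps : R) :
  (0 < p)%N ->
  (forall j, Sigma j j = d j ^+ 2) -> (forall j, 0 < d j) ->
  (forall j k, j != k -> Sigma j k <= (1 - kappa) * (d j * d k)) ->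
  0 < kappa <= 1 -> 0 <= eps <= kappa / 4 ->
  (forall j k, `|(S - Sigma) j k| <= eps * (d j * d k)) ->
  exists A, is_mle S A.
Proof.
move=> p0 Sd d0 So /andP[k0 k1] /andP[e0 e4] SE.
pose m := \big[Num.min/1]_j d j ^+ 2.
have m0 : 0 < m by apply: lt_bigmin => [|j _]; first exact: ltr01; rewrite exprn_gt0.
apply: (@mle_exists R p S (kappa / 2 * m)) => //.
  by rewrite mulr_gt0// divr_gt0.
move=> B BM.
apply: (@le_trans _ _ ((kappa - 2 * eps) * (\sum_j B j j * d j ^+ 2))); last first.
  apply: frob_ge => //; last by lra.
  - move=> j; have := SE j j; rewrite !mxE Sd ler_norml => /andP[h _]; lra.
  - move=> j k jk; have := SE j k; have := So j k jk.
    rewrite !mxE ler_norml => h1 /andP[_ h2]; lra.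
have Bd j : 0 <= B j j by apply: psd_diag_ge0; exact: BM.1.
rewrite -mulrA; apply: ler_pM; [lra| |lra|].
  by rewrite mulr_ge0 ?(ltW m0)// /mxtrace sumr_ge0.
rewrite /mxtrace mulr_sumr; apply: ler_sum => j _.
by rewrite mulrC ler_wpM2l//; exact: bigmin_le.
Qed.

(** * Correlations and normalized probe directions *)

Definition std p (A : 'M[R]_p) (j : 'I_p) : R := Num.sqrt (A j j).

Lemma posdef_diag_gt0 p (A : 'M[R]_p) j : posdef A -> 0 < A j j.
Proof.
move=> [_ /(_ (1 *: delta_mx j 0 + 0 *: delta_mx j 0))].
rewrite quadform_delta2 scale0r addr0 scale1r.
have -> : (delta_mx j 0 : 'cV[R]_p) != 0.
  by apply/negP => /eqP/colP/(_ j)/eqP; rewrite !mxE !eqxx oner_eq0.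
by move=> /(_ isT); lra.
Qed.

Lemma std_gt0 p (A : 'M[R]_p) j : posdef A -> 0 < std A j.
Proof. by move=> Apd; rewrite sqrtr_gt0 posdef_diag_gt0. Qed.

Lemma sqr_std p (A : 'M[R]_p) j : posdef A -> A j j = std A j ^+ 2.
Proof. by move=> Apd; rewrite sqr_sqrtr// ltW// posdef_diag_gt0. Qed.

(** The boolean is the sign, [true] standing for minus. Pairs with j = k are kept, so the index set
    has exactly 2 p^2 elements; such a probe is 2 e_j / d_j or 0. *)
Definition probe p (A : 'M[R]_p) (jkb : 'I_p * 'I_p * bool) : 'cV[R]_p :=
  (std A jkb.1.1)^-1 *: delta_mx jkb.1.1 0 +
  ((-1) ^+ jkb.2 / std A jkb.1.2) *: delta_mx jkb.1.2 0.

(** The lower bound is the initial value of the maximum. Strictness above comes from positive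
    definiteness along d_k e_j - d_j e_k, where the form equals 2 d_j d_k (d_j d_k - A_jk). *)
Lemma max_corr_bounds p (A : 'M[R]_p) : posdef A ->
  -1 <= max_corr A < 1 /\
  forall j k, j != k -> A j k <= max_corr A * (std A j * std A k).
Proof.
move=> Apd.
have corrE j k : Num.sqrt (A j j * A k k) = std A j * std A k.
  by rewrite sqrtrM// ltW// posdef_diag_gt0.
have s0 j := std_gt0 j Apd.
split; last first.
  move=> j k jk; rewrite -ler_pdivrMr ?mulr_gt0// -corrE.
  exact: (le_bigmax_cond _ (fun jk : 'I_p * 'I_p =>
    A jk.1 jk.2 / Num.sqrt (A jk.1 jk.1 * A jk.2 jk.2)) (j := (j, k))).
apply/andP; split; first exact: bigmax_ge_id.
apply/bigmax_ltP; split => // -[j k] /= jk.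
rewrite corrE ltr_pdivrMr ?mulr_gt0// mul1r.
have := Apd.2 (std A k *: delta_mx j 0 + (- std A j) *: delta_mx k 0).
have -> : std A k *: delta_mx j 0 + (- std A j) *: delta_mx k 0 != 0 :> 'cV[R]_p.
  apply/negP => /eqP/colP/(_ j)/eqP; rewrite !mxE !eqxx (negbTE jk) mulr0 addr0.
  by rewrite mulr1 gt_eqF.
move=> /(_ isT); rewrite quadform_delta2 -(psd_sym (posdef_psd Apd) j k).
rewrite (sqr_std j Apd) (sqr_std k Apd) => h.
have : 0 < (std A j * std A k) * (2 * (std A j * std A k - A j k)) by lra.
by rewrite (pmulr_rgt0 _ (mulr_gt0 (s0 j) (s0 k))); lra.
Qed.

(* Polarization along the probes recovers every entry. *)
Lemma entry_le_probe p (A E : 'M[R]_p) (eps : R) : posdef A -> E^T = E ->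
  (forall t, `|quadform E (probe A t)| <= eps * quadform A (probe A t)) ->
  forall j k, `|E j k| <= eps * (std A j * std A k).
Proof.
move=> Apd Et EA j k.
have := EA (j, k, true); have := EA (j, k, false).
rewrite /probe /= expr0 expr1 !quadform_delta2.
have -> : E k j = E j k by rewrite -{1}Et mxE.
rewrite -(psd_sym (posdef_psd Apd) j k).
have sj := std_gt0 j Apd; have sk := std_gt0 k Apd.
rewrite (sqr_std j Apd) (sqr_std k Apd).
have -> : (std A j)^-1 ^+ 2 * std A j ^+ 2 = 1 by field; rewrite gt_eqF.
have -> : (1 / std A k) ^+ 2 * std A k ^+ 2 = 1 by field; rewrite gt_eqF.
have -> : (-1 / std A k) ^+ 2 * std A k ^+ 2 = 1 by field; rewrite gt_eqF.
set a := (std A j)^-1; have aE : a * std A j = 1 by rewrite mulVf// gt_eqF.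
rewrite mul1r mulN1r; set b := (std A k)^-1.
have bE : b * std A k = 1 by rewrite mulVf// gt_eqF.
rewrite !ler_norml => /andP[l1 u1] /andP[l2 u2].
have ab0 : 0 < a * b by rewrite mulr_gt0// invr_gt0.
(* The two forms of E differ by 4 a b E_jk, while the two forms of A sum to 4, their cross terms
   cancelling. *)
suff : `|(a * b) * E j k| <= eps.
  rewrite normrM gtr0_norm// -ler_pdivlMl// /a /b invfM !invrK.
  by rewrite -ler_norml [_ * eps]mulrC.
rewrite ler_norml; apply/andP; split; lra.
Qed.

End Deterministic.

(** * Concentration of the sample covariance *)

Section Probability.
Context {R : realType}.

(** Row independence is stated for Borel sets of R^p, and the chi-square bound concerns real
    projections. The sets with Borel preimage form a sigma-algebra containing the open
    half-lines. *)
Lemma borel_linear_form p (u : 'cV[R]_p) (B : set R) : measurable B ->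
  <<s [set U : set 'rV[R]_p | open U] >> [set y | B ((y *m u) 0 0)].
Proof.
rewrite [measurable B](_ : _ = (@RGenInftyO.G R).-sigma.-measurable B); last first.
  by rewrite -RGenInftyO.measurableE.
pose f (y : 'rV[R]_p) : R := (y *m u) 0 0.
have fc : continuous f.
  rewrite /f; under eq_fun do rewrite mxE.
  apply: continuous_bigsum => k; apply: continuous_mulr.
    exact: coord_continuous.
  exact: cst_continuous.
suff H : <<s @RGenInftyO.G R >> `<=`
    [set A | <<s [set U : set 'rV[R]_p | open U] >> (f @^-1` A)].
  exact: H.
apply: smallest_sub.
  split => /=.
  - by rewrite preimage_set0; exact: sigma_algebra0.
  - move=> A mA; rewrite setTD preimage_setC; exact: sigma_algebraC.
  - by move=> F mF; rewrite preimage_bigcup; exact: sigma_algebra_bigcup.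
move=> _ [x ->] /=; apply: sub_sigma_algebra => /=.
apply: open_comp; last exact: interval_open.
by move=> y _; exact: fc.
Qed.

Lemma quadform_sample_cov n p (X : 'M[R]_(n, p)) (u : 'cV[R]_p) :
  quadform (sample_cov X) u =
  n%:R^-1 * \sum_(i < n) ((row i X *m u) 0 0) ^+ 2.
Proof.
rewrite /sample_cov quadformZl /quadform; congr (_ * _).
have -> : u^T *m (X^T *m X) *m u = (X *m u)^T *m (X *m u).
  by rewrite trmx_mul !mulmxA.
rewrite mxE; apply: eq_bigr => i _.
by rewrite -row_mul !mxE expr2.
Qed.

Lemma quadformBl p (A B : 'M[R]_p) u :
  quadform (A - B) u = quadform A u - quadform B u.
Proof. by rewrite -[- B]scaleN1r quadformDl quadformZl mulN1r. Qed.

Context (d : measure_display) (T : measurableType d) (P : probability T R).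
Local Open Scope ereal_scope.

(** The error is measured relative to the variance along u, so one tail bound fits all directions;
    the strict inequality makes the event empty for u = 0. *)
Definition deviation n p (Sigma : 'M[R]_p) (X : T -> 'M[R]_(n, p)) (eps : R)
    (u : 'cV[R]_p) : set T :=
  [set w | eps * quadform Sigma u < `|quadform (sample_cov (X w) - Sigma) u|]%R.

Lemma deviation_tail n p (Sigma : 'M[R]_p) (X : T -> 'M[R]_(n, p)) (eps : R) u :
  (0 < n)%N -> posdef Sigma -> iid_gaussian_rows P Sigma X ->
  (0 < eps <= 4^-1)%R ->
  measurable (deviation Sigma X eps u) /\
  P (deviation Sigma X eps u) <= (2 * expR (- (n%:R * eps ^+ 2 / 8)))%:E.
Proof.
move=> n0 Spd [mX gX iX] e01.
pose Z (i : 'I_n) w : R := ((row i (X w) *m u) 0 0)%R.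
have mZ i : measurable_fun setT (Z i).
  have -> : Z i = fun w => (\sum_j X w i j * u j 0)%R.
    by apply/funext => w; rewrite /Z mxE; apply: eq_bigr => j _; rewrite mxE.
  by apply: measurable_sum => j; exact: measurable_funM.
have badE : deviation Sigma X eps u = [set w | eps * quadform Sigma u <
    `|n%:R^-1 * (\sum_(i < n) Z i w ^+ 2) - quadform Sigma u|]%R.
  by apply/seteqP; split => w; rewrite /deviation /= quadformBl quadform_sample_cov.
split.
  rewrite badE.
  have mq : measurable_fun setT (fun w => `|n%:R^-1 * (\sum_(i < n) Z i w ^+ 2) -
      quadform Sigma u|)%R.
    apply: measurableT_comp => //; apply: measurable_funB => //.
    by apply: measurable_funM => //; exact: measurable_sum_sqr.
  move: (mq measurableT `](eps * quadform Sigma u)%R, +oo[%classic (measurable_itv _)).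
  rewrite setTI; congr (measurable _).
  by apply/seteqP; split => w /=; rewrite in_itv/= andbT.
(* The Gaussian hypothesis covers only nonzero u, and a probe can vanish. *)
have [u0|u0] := eqVneq u 0%R.
  have -> : deviation Sigma X eps u = set0.
    apply/seteqP; split => w //; rewrite /deviation /= u0 /quadform !mulmx0 !mxE.
    by rewrite mulr0 normr0 ltxx.
  by rewrite measure0 lee_fin mulr_ge0// expR_ge0.
pose s := Num.sqrt (quadform Sigma u).
have s0 : (0 < s)%R by rewrite sqrtr_gt0 Spd.2.
have s2 : (s ^+ 2 = quadform Sigma u)%R by rewrite sqr_sqrtr// ltW// Spd.2.
rewrite badE -s2; apply: chi_square_tail => // B mB.
have := iX (fun i => [set y | B i ((y *m u) 0 0)%R])
  (fun i => borel_linear_form u (mB i)).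
move=> ->; apply: eq_bigr => i _.
exact: (gX i u u0 (B i) (mB i)).
Qed.

Lemma measure_bigsetU_le (I : Type) (r : seq I) (B : I -> set T) :
  (forall i, measurable (B i)) ->
  P (\big[setU/set0]_(i <- r) B i) <= \sum_(i <- r) P (B i).
Proof.
move=> mB; elim: r => [|i r IH]; first by rewrite !big_nil measure0.
rewrite !big_cons; apply: le_trans (measureU2 _ _ _) _ => //.
  by apply: bigsetU_measurable => *.
by rewrite leeD2l.
Qed.

End Probability.

(** * Choice of constants and union bound *)

Unset Implicit Arguments.
Set Strict Implicit.

Theorem theorem1 (R : realType) :
  exists c1 c2 c3 : R, [/\ 0 < c1, 0 < c2, 0 < c3 &
    forall (n p : nat), (2 <= n)%N -> (2 <= p)%N ->
    forall Sigma : 'M[R]_p, posdef Sigma -> Mset (invmx Sigma) ->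
    forall (d : measure_display) (T : measurableType d) (P : probability T R)
      (X : T -> 'M[R]_(n, p)),
    iid_gaussian_rows P Sigma X ->
    forall Theta_hat : T -> 'M[R]_p,
    (forall w, (exists A, is_mle (sample_cov (X w)) A) ->
       is_mle (sample_cov (X w)) (Theta_hat w)) ->
    c1 * gamma Sigma ^+ 2 * ln p%:R <= n%:R ->
    exists E : set T,
      [/\ measurable E,
          ((1 - c3 * p%:R ^- 2)%:E <= P E)%E
        & forall w, E w ->
            ssym_loss (Theta_hat w) (invmx Sigma) <=
            c2 * gamma Sigma * Num.sqrt (ln p%:R / n%:R)]].
Proof.
(* 2304 = 48^2 gives 48 s <= 1 - m below; 36 is 3 eps / kappa with eps = 6 s and kappa = (1 - m) /
   2; 4 comes from 2 p^2 probes, each failing with probability at most 2 p^-4. *)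
exists 2304, 36, 4; split; [lra|lra|lra|].
move=> n p n2 p2 Sigma Spd SM d T P X iX Theta_hat mle nlarge.
have n0 : (0 < n)%N by apply: leq_trans n2.
have p0 : (0 < p)%N by apply: leq_trans p2.
have nR0 : 0 < n%:R :> R by rewrite ltr0n.
have pR0 : 0 < p%:R :> R by rewrite ltr0n.
have [/andP[m1 m1'] corr] := max_corr_bounds Spd.
set m := max_corr Sigma in m1 m1' corr.
have gE : gamma Sigma = (1 - m)^-1 by [].
have m0 : 0 < 1 - m by rewrite subr_gt0.
(* As m >= -1, halving the gap ensures kappa <= 1, and 1 - kappa = (1 + m) / 2 still dominates m. *)
pose kappa := (1 - m) / 2.
have k01 : 0 < kappa <= 1 by rewrite /kappa; apply/andP; split; lra.
pose L := ln p%:R : R; rewrite -/L in nlarge *.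
have L0 : 0 < L by rewrite ln_gt0// ltr1n.
pose s := Num.sqrt (L / n%:R); rewrite -/s.
have s0 : 0 < s by rewrite sqrtr_gt0 divr_gt0.
have s2 : n%:R * s ^+ 2 = L.
  rewrite sqr_sqrtr; last by rewrite ltW// divr_gt0.
  by field; rewrite gt_eqF.
have sk : 48 * s <= 1 - m.
  rewrite -(@ler_pXn2r _ 2) ?nnegrE ?(ltW m0) ?mulr_ge0 ?(ltW s0)//.
  rewrite exprMn -(ler_pM2l nR0) mulrCA s2.
  have := ler_wpM2r (ltW (exprn_gt0 2 m0)) nlarge.
  rewrite gE exprVn; have -> : 2304 * (1 - m) ^- 2 * L * (1 - m) ^+ 2 = 2304 * L.
    by field; rewrite gt_eqF.
  by lra.
(* Then n eps^2 / 8 = 4.5 ln p >= 4 ln p, and 48 s <= 1 - m is exactly eps <= kappa / 4. *)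
pose eps := 6 * s.
have e0 : 0 < eps by rewrite mulr_gt0.
have ek : 0 <= eps <= kappa / 4.
  by rewrite ltW//= /eps /kappa; lra.
have e4 : 0 < eps <= 4^-1 by rewrite e0 /eps; lra.
pose bad t := deviation Sigma X eps (probe Sigma t).
have badP t := deviation_tail (probe Sigma t) n0 Spd iX e4.
pose U := \big[setU/set0]_t bad t.
have mU : measurable U by apply: bigsetU_measurable => t _; exact: (badP t).1.
(* The event is defined by the deviations along the probes, not by the loss, which gives its
   measurability. *)
exists (~` U); split; first exact: measurableC.
  rewrite probability_setC// EFinB leeB//.
  apply: le_trans (measure_bigsetU_le _ _ _) _; first by move=> t; exact: (badP t).1.
  apply: (@le_trans _ _ (\sum_(t : 'I_p * 'I_p * bool) (2 * p%:R ^- 4)%:E)%E).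
    apply: lee_sum => t _; apply: le_trans (badP t).2 _; rewrite lee_fin.
    apply: ler_wpM2l => //; rewrite /eps exprMn mulrCA s2.
    apply: (@le_trans _ _ (expR (- (4 * L)))); first by rewrite ler_expR; lra.
    by rewrite expRN expRM_natl lnK ?posrE.
  rewrite sumEFin lee_fin sumr_const card_prod card_prod card_ord card_bool.
  rewrite -[X in X <= _]mulr_natl !natrM le_eqVlt; apply/orP; left; apply/eqP.
  by field; rewrite gt_eqF.
move=> w Uw.
have good t : `|quadform (sample_cov (X w) - Sigma) (probe Sigma t)| <=
    eps * quadform Sigma (probe Sigma t).
  rewrite leNgt; apply/negP => bw; apply: Uw.
  by rewrite /U (bigD1 t)//=; left.
have Ssym : (sample_cov (X w) - Sigma)^T = sample_cov (X w) - Sigma.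
  by rewrite linearB /= Spd.1 /sample_cov linearZ /= trmx_mul trmxK.
have near := entry_le_probe Spd Ssym good.
have Sd j := sqr_std j Spd.
have sd0 j := std_gt0 j Spd.
have corr' j k : j != k -> Sigma j k <= (1 - kappa) * (std Sigma j * std Sigma k).
  move=> jk; apply: le_trans (corr j k jk) _; apply: ler_wpM2r.
    by rewrite mulr_ge0// ltW.
  by rewrite /kappa; lra.
have mleT := mle w (mle_exists_near p0 Sd sd0 corr' k01 ek near).
apply: le_trans (ssym_loss_le p0 Spd SM mleT Sd corr' k01 ek near) _.
rewrite gE /eps /kappa le_eqVlt; apply/orP; left; apply/eqP.
by field; rewrite gt_eqF.
Qed.
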